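(* Let $A\in\mathcal{B}(\mathcal{H})$ be a positive operator such that $R(A)$ is closed, and let $q\in\mathcal{D}$. If $T\in\mathcal{B}_{A^{1/2}}(\mathcal{H})$ is an $A$-nilpotent operator of index $2$, then $W_{q,A}(T)$ is a disk (open or closed) in $\mathbb{C}$ with center at $0$, and $$w_{q,A}(T)\le\left(\frac{1+\sqrt{1-|q|^2}}{2}\right)\|T\|_A.$$
   Context: $\mathcal{H}$ is a separable infinite-dimensional complex Hilbert space with inner product $\langle\cdot,\cdot\rangle$ (linear in the first variable); $\mathcal{B}(\mathcal{H})$ is the algebra of bounded linear operators on $\mathcal{H}$; $R(A)$ is the range of $A$. $A$ positive means $\langle Ax,x\rangle\ge 0$ for all $x$. Put $\langle x,y\rangle_A=\langle Ax,y\rangle$ and $\|x\|_A=\sqrt{\langle x,x\rangle_A}$. $\mathcal{D}=\{z\in\mathbb{C}:|z|\le 1\}$. $\mathcal{B}_{A^{1/2}}(\mathcal{H})=\{T\in\mathcal{B}(\mathcal{H}):\exists c>0,\ \|Tx\|_A\le c\|x\|_A\ \forall x\in\mathcal{H}\}$; for such $T$, $\|T\|_A=\sup\{\|Tx\|_A/\|x\|_A: x\in\overline{R(A)},\ x\ne 0\}$. $T\in\mathcal{B}_{A^{1/2}}(\mathcal{H})$ is $A$-nilpotent of index $k\in\mathbb{N}$ if $AT^k=0$ but $AT^{k-1}\ne 0$. The $A$-$q$-numerical range is $W_{q,A}(T)=\{\langle Tx,y\rangle_A: x,y\in\mathcal{H},\ \|x\|_A=\|y\|_A=1,\ \langle x,y\rangle_A=q\}$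 and the $A$-$q$-numerical radius is $w_{q,A}(T)=\sup\{|\lambda|:\lambda\in W_{q,A}(T)\}$. *)

(* Defs.v *)
From HB Require Import structures.
From mathcomp Require Import all_boot all_order all_algebra.
From mathcomp Require Import sesquilinear complex.
From mathcomp Require Import all_classical all_reals all_analysis.

Set Implicit Arguments.
Unset Strict Implicit.
Unset Printing Implicit Defensive.

Import Order.TTheory GRing.Theory Num.Theory.
Import numFieldNormedType.Exports.

Local Open Scope classical_set_scope.
Local Open Scope ring_scope.
Local Open Scope complex_scope.

(* A complex Hilbert space is given as a complete normed module H over R[i]
   with a positive definite Hermitian form dot inducing its norm. The form
   type {dot H for theta} is linear in its first argument. *)
Definition inner_product_norm (R : realType) (H : normedModType R[i])
    (dot : {dot H for Num.Def.conjC}) : Prop :=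
  forall x : H, `|x| ^+ 2 = dot x x.

Definition separable (T : topologicalType) : Prop :=
  exists S : set T, countable S /\ dense S.

Definition finite_dimensional (K : fieldType) (V : lmodType K) : Prop :=
  exists (n : nat) (b : 'I_n -> V),
    forall x : V, exists c : 'I_n -> K, x = \sum_(i < n) c i *: b i.

Definition modulus (R : realType) (z : R[i]) : R := ComplexField.Normc.normc z.

Definition is_disk (R : realType) (c : R[i]) (S : set R[i]) : Prop :=
  exists r : R, 0 < r /\
    (S = [set z | modulus (z - c) < r] \/ S = [set z | modulus (z - c) <= r]).

Section ASemiInner.
Context (R : realType) (H : normedModType R[i]).
Variable dot : {dot H for Num.Def.conjC}.

Definition bounded_operator (T : {linear H -> H}) : Prop :=
  exists c : R, forall x : H, `|T x| <= c%:C * `|x|.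

(* The order of R[i] is partial: 0 <= z says that z is real and nonnegative. *)
Definition positive_operator (A : {linear H -> H}) : Prop :=
  forall x : H, 0 <= dot (A x) x.

Variable A : {linear H -> H}.

Definition inner_A (x y : H) : R[i] := dot (A x) y.

(* For positive A, inner_A x x is real, so Re only changes its type. *)
Definition norm_A (x : H) : R := Num.sqrt (complex.Re (inner_A x x)).

Definition A_bounded (T : {linear H -> H}) : Prop :=
  exists c : R, 0 < c /\ forall x : H, norm_A (T x) <= c * norm_A x.

(* Suprema are taken in the extended reals, where they have no default value
   for unbounded sets. *)
Definition opnorm_A (T : {linear H -> H}) : \bar R :=
  ereal_sup [set (norm_A (T x) / norm_A x)%:E |
              x in [set x | closure (range A) x /\ x <> 0]].

Definition A_nilpotent (k : nat) (T : {linear H -> H}) : Prop :=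
  [/\ (0 < k)%N,
      forall x : H, A (iter k T x) = 0 &
      exists x : H, A (iter k.-1 T x) <> 0].

Definition numerical_range_A (q : R[i]) (T : {linear H -> H}) : set R[i] :=
  [set z | exists x y : H,
    [/\ norm_A x = 1, norm_A y = 1, inner_A x y = q & z = inner_A (T x) y]].

Definition numerical_radius_A (q : R[i]) (T : {linear H -> H}) : \bar R :=
  ereal_sup [set (modulus z)%:E | z in numerical_range_A q T].

End ASemiInner.

(* Main.v *)
Require Import Defs.
From HB Require Import structures.
From mathcomp Require Import all_boot all_order all_algebra.
From mathcomp Require Import sesquilinear complex.
From mathcomp Require Import all_classical all_reals all_analysis.
From mathcomp Require Import ring lra.

Set Implicit Arguments.
Unset Strict Implicit.
Unset Printing Implicit Defensive.

Import Order.TTheory GRing.Theory Num.Theory.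
Import numFieldNormedType.Exports.

Local Open Scope classical_set_scope.
Local Open Scope ring_scope.
Local Open Scope complex_scope.

(** Write B x y = <Ax, y>, a positive semidefinite Hermitian form, and W for
    the set of the values B (Tx) y over the pairs of B-unit vectors x, y with
    B x y = q. The hypothesis A T^2 = 0 says that T (Tx) is B-orthogonal to
    everything, so it is negligible for every computation below.

    Take a pair x, y with Tx not B-null, put e = Tx / ||Tx|| and split
    x = a e + v, y = b e + v' with v, v' orthogonal to e. Since Te is
    negligible, Tv and Tx are interchangeable ([range_frame]), so the value of
    the pair is ||Tx|| conj(b) and ||Tx|| = ||Tv||. Everything is
    read off this splitting along the single vector e.

    - Rotation: replacing v, v' by w v, w v' with |w| = 1 keeps all the
      constraints and multiplies the value by w ([qrange_rotate]).
    - Shrinking: rotate x and y simultaneously in the plane spanned by e and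
      v, moving x continuously to a multiple of e. The value moves
      continuously to 0, so every smaller modulus is attained
      ([qrange_shrink]).
    - Bound: the value is at most ||T|| ||v|| |b|, and the constraints give
      |a|^2 + ||v||^2 = |b|^2 + ||v'||^2 = 1 and |q| <= |a||b| + ||v|| ||v'||.
      Writing these numbers as sines and cosines, ||v|| |b| is
      sin s cos t = (sin (s + t) + sin (s - t)) / 2 with |q| <= cos (s - t)
      ([half_bound], [qrange_bound]).

    Rotation and shrinking say that W contains, with each point, the closed
    disk centered at 0 through that point; a bounded set of this kind with a
    nonzero point ([qrange_neq0]) is an open or closed disk
    ([balanced_is_disk]).

    The A-operator norm is a supremum over the closure of the range of A only.
    It controls T on all of H because the range of A is dense for the
    A-seminorm ([range_seminorm_dense]), as a gradient descent shows. *)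

(** * The modulus of a complex number *)

Lemma conjCE (R : realType) (z : R[i]) : Num.conj z = conjc z.
Proof. by []. Qed.

Lemma modulusE (R : realType) (z : R[i]) : (modulus z)%:C = `|z|.
Proof. by []. Qed.

Lemma modulus_ge0 (R : realType) (z : R[i]) : 0 <= modulus z.
Proof. by rewrite -ler0c modulusE. Qed.

Lemma modulus_sqr (R : realType) (z : R[i]) :
  (modulus z ^+ 2)%:C = z * Num.conj z.
Proof. by rewrite rmorphXn /= modulusE normCK. Qed.

Lemma modulusM (R : realType) (z w : R[i]) :
  modulus (z * w) = modulus z * modulus w.
Proof. exact: ComplexField.Normc.normcM. Qed.

Lemma modulusV (R : realType) (z : R[i]) : modulus z^-1 = (modulus z)^-1.
Proof. exact: ComplexField.Normc.normcV. Qed.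

Lemma modulusJ (R : realType) (z : R[i]) : modulus (Num.conj z) = modulus z.
Proof. by apply: complexI; rewrite !modulusE norm_conjC. Qed.

Lemma modulusD (R : realType) (z w : R[i]) :
  modulus (z + w) <= modulus z + modulus w.
Proof. by rewrite -lecR rmorphD /= !modulusE ler_normD. Qed.

Lemma modulusR (R : realType) (r : R) : modulus r%:C = `|r|.
Proof. by rewrite /modulus /= expr0n /= addr0 sqrtr_sqr. Qed.

Lemma modulus_eq0 (R : realType) (z : R[i]) : (modulus z == 0) = (z == 0).
Proof. by rewrite -(inj_eq (@complexI R)) modulusE normr_eq0. Qed.

Lemma Re_ge0K (R : realType) (z : R[i]) : 0 <= z -> (complex.Re z)%:C = z.
Proof. by move=> /ger0_real/RRe_real. Qed.

(** * Positive semidefinite Hermitian forms *)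

Record semi_inner (R : realType) (V : lmodType R[i]) (B : V -> V -> R[i]) :
  Prop := SemiInner {
    siDl : forall x y z, B (x + y) z = B x z + B y z;
    siZl : forall a x z, B (a *: x) z = a * B x z;
    siC : forall x y, B x y = Num.conj (B y x);
    si_ge0 : forall x, 0 <= B x x }.

Definition seminorm (R : realType) (V : lmodType R[i])
  (B : V -> V -> R[i]) (x : V) : R := Num.sqrt (complex.Re (B x x)).

Section SemiInnerTheory.
Context (R : realType) (V : lmodType R[i]) (B : V -> V -> R[i]).
Hypothesis BP : semi_inner B.

Lemma siDr x y z : B z (x + y) = B z x + B z y.
Proof. by rewrite (siC BP) (siDl BP) rmorphD /= -!(siC BP). Qed.

Lemma siZr a x z : B z (a *: x) = Num.conj a * B z x.
Proof. by rewrite (siC BP) (siZl BP) rmorphM /= -!(siC BP). Qed.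

Lemma si0l z : B 0 z = 0.
Proof. by rewrite -[X in B X _](scale0r 0) (siZl BP) mul0r. Qed.

Lemma siNl x z : B (- x) z = - B x z.
Proof. by rewrite -scaleN1r (siZl BP) mulN1r. Qed.

Lemma siNr x z : B z (- x) = - B z x.
Proof. by rewrite -scaleN1r siZr rmorphN1 mulN1r. Qed.

Lemma si_eq0C x y : B x y = 0 -> B y x = 0.
Proof. by move=> xy0; rewrite (siC BP) xy0 rmorph0. Qed.

Lemma seminorm_ge0 x : 0 <= seminorm B x.
Proof. exact: sqrtr_ge0. Qed.

Lemma seminormE x : B x x = (seminorm B x ^+ 2)%:C.
Proof.
have Bx := si_ge0 BP x.
by rewrite sqr_sqrtr ?Re_ge0K // -ler0c Re_ge0K.
Qed.

Lemma seminorm_eq1 x : (seminorm B x = 1) <-> (B x x = 1).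
Proof.
split=> [x1|]; first by rewrite seminormE x1 expr1n.
by rewrite /seminorm => -> /=; rewrite sqrtr1.
Qed.

(** The form may be degenerate. Positivity is used at x - (t B x y) y for real
    t only, and t = 1 / B y y is the usual choice when y is not null. When y
    is null, the quadratic in t degenerates to an affine function that is
    bounded below, so its slope, |B x y|^2 up to a factor, is zero. *)
Lemma cauchy_schwarz x y : modulus (B x y) <= seminorm B x * seminorm B y.
Proof.
have h (t : R) : 0 <= seminorm B x ^+ 2 - 2 * t * modulus (B x y) ^+ 2
    + t ^+ 2 * modulus (B x y) ^+ 2 * seminorm B y ^+ 2.
  have := si_ge0 BP (x - (t%:C * B x y) *: y).
  rewrite (siDl BP) !siDr !siNl !siNr !(siZl BP) !siZr rmorphM /=.
  rewrite !seminormE [B y x](siC BP) [Num.conj t%:C]conjc_real => H.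
  rewrite -ler0c; apply: le_trans H _; rewrite le_eqVlt; apply/orP; left.
  apply/eqP; move: (modulus_sqr (B x y)); move: (modulus _ ^+ 2) => m mE.
  rewrite [t ^+ 2]expr2 !(rmorphD, rmorphN, rmorphM) ?rmorph_nat ?rmorph1 /= mE.
  ring.
have x0 := seminorm_ge0 x; have y0 := seminorm_ge0 y.
have m0 := modulus_ge0 (B x y).
move: h x0 y0 m0.
move: (seminorm B x) (seminorm B y) (modulus (B x y)) => a d m h a0 d0 m0.
rewrite -(@ler_pXn2r _ 2) ?nnegrE ?mulr_ge0 // exprMn.
have [d00|dn0] := eqVneq d 0.
  suff -> : m = 0 by rewrite expr0n mulr_ge0 ?sqr_ge0.
  apply: contrapT => /eqP mn0.
  (* This t brings the affine function down to -1. *)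
  have := h ((a ^+ 2 + 1) / (2 * m ^+ 2)).
  rewrite d00 expr0n /= mulr0 addr0.
  have -> : 2 * ((a ^+ 2 + 1) / (2 * m ^+ 2)) * m ^+ 2 = a ^+ 2 + 1 by field.
  lra.
have := h (d ^+ 2)^-1.
have -> : a ^+ 2 - 2 / d ^+ 2 * m ^+ 2 + (d ^+ 2)^-1 ^+ 2 * m ^+ 2 * d ^+ 2 =
  (a ^+ 2 * d ^+ 2 - m ^+ 2) / d ^+ 2 by field.
by rewrite pmulr_lge0 ?invr_gt0 ?exprn_gt0 // ?subr_ge0 // lt_def dn0.
Qed.

Lemma seminormD x y : seminorm B (x + y) <= seminorm B x + seminorm B y.
Proof.
rewrite -(@ler_pXn2r _ 2) ?nnegrE ?addr_ge0 ?seminorm_ge0 //.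
rewrite -lecR -seminormE (siDl BP) !siDr !seminormE [B y x](siC BP).
have -> : forall z : R[i], (seminorm B x ^+ 2)%:C + z +
   (Num.conj z + (seminorm B y ^+ 2)%:C) =
   (seminorm B x ^+ 2 + 2 * complex.Re z + seminorm B y ^+ 2)%:C.
  move=> z; have zE : z + Num.conj z = (2 * complex.Re z)%:C.
    by rewrite rmorphM rmorph_nat -complex.addcJ conjCE.
  by rewrite addrA -[_ + z + _]addrA zE -!rmorphD.
rewrite lecR.
have : complex.Re (B x y) <= seminorm B x * seminorm B y.
  apply: le_trans (cauchy_schwarz x y).
  by rewrite -lecR (le_trans _ (normc_ge_Re _)) // lecR ler_norm.
nra.
Qed.

Lemma seminormN x : seminorm B (- x) = seminorm B x.
Proof. by rewrite /seminorm siNl siNr opprK. Qed.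

Lemma si_cat e x1 y1 u v :
  B e e = 1 -> B u e = 0 -> B v e = 0 ->
  B (x1 *: e + u) (y1 *: e + v) = x1 * Num.conj y1 + B u v.
Proof.
move=> e1 ue ve.
rewrite (siDl BP) !siDr !(siZl BP) !siZr e1 ue (si_eq0C ve); ring.
Qed.

Lemma si_split e y : B e e = 1 ->
  exists2 v, y = B y e *: e + v & B v e = 0.
Proof.
move=> e1; exists (y - B y e *: e); first by rewrite addrC subrK.
by rewrite (siDl BP) siNl (siZl BP) e1 mulr1 subrr.
Qed.

Lemma si_unit_coord e g u : B e e = 1 -> B u e = 0 ->
  B e (g *: e + u) = Num.conj g.
Proof.
by move=> e1 ue; rewrite siDr siZr e1 (si_eq0C ue) mulr1 addr0.
Qed.

Lemma seminorm_gt0 x y : B x y != 0 -> 0 < seminorm B x.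
Proof.
move=> xy; rewrite lt_def seminorm_ge0 andbT; apply: contra xy => /eqP x0.
rewrite -modulus_eq0 eq_le modulus_ge0 andbT.
by apply: le_trans (cauchy_schwarz x y) _; rewrite x0 mul0r.
Qed.

End SemiInnerTheory.

(** * Disks, a trigonometric inequality and a path of rotations *)

(** The radius is the supremum of the moduli; the disk is closed or open
    according to whether this supremum is attained. *)
Lemma balanced_is_disk (R : realType) (S : set R[i]) (M : R) :
  (forall z w, S z -> modulus w <= modulus z -> S w) ->
  (forall z, S z -> modulus z <= M) ->
  (exists2 z, S z & z != 0) -> is_disk 0 S.
Proof.
move=> bal bnd [z0 Sz0 z0n0].
pose E := [set modulus z | z in S].
have hE : has_sup E.
  split; first by exists (modulus z0), z0.
  by exists M => _ [z Sz <-]; exact: bnd.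
have ub z : S z -> modulus z <= sup E.
  by move=> Sz; apply: sup_upper_bound => //; exists z.
have r0 : 0 < sup E.
  by rewrite (lt_le_trans _ (ub _ Sz0)) // lt_def modulus_eq0 z0n0 modulus_ge0.
exists (sup E); split=> //.
have [[z1 [Sz1 z1E]]|nS] := pselect (exists z, S z /\ modulus z = sup E).
  right; apply/seteqP; split=> z /=; rewrite subr0; first exact: ub.
  by rewrite -z1E; exact: bal.
left; apply/seteqP; split=> z /=; rewrite subr0.
  move=> Sz; rewrite lt_neqAle ub // andbT.
  by apply/eqP => zE; apply: nS; exists z.
move=> zlt; have e0 : 0 < sup E - modulus z by rewrite subr_gt0.
have [_ [w Sw <-]] := sup_adherent e0 hE; rewrite subKr => zw.
exact: bal Sw (ltW zw).
Qed.

(** With a = cos s, b = sin s, c = cos t, d = sin t, this is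
    sin s cos t = (sin (s + t) + sin (s - t)) / 2, where the first sine is at
    most 1 and the second at most sqrt (1 - q^2) as q <= cos (s - t). The two
    sines are b c + a d and b c - a d; the addition formulas become the
    two-square identity. *)
Lemma half_bound (R : realType) (q a b c d : R) :
  0 <= q <= a * c + b * d -> 0 <= a -> 0 <= b -> 0 <= c -> 0 <= d ->
  a ^+ 2 + b ^+ 2 = 1 -> c ^+ 2 + d ^+ 2 = 1 ->
  b * c <= (1 + Num.sqrt (1 - q ^+ 2)) / 2.
Proof.
move=> /andP[q0 qle] a0 b0 c0 d0 ab cd.
have ple : b * c + a * d <= 1.
  rewrite -(@ler_pXn2r _ 2) ?nnegrE ?addr_ge0 ?mulr_ge0 // expr1n.
  have -> : (b * c + a * d) ^+ 2 = (a ^+ 2 + b ^+ 2) * (c ^+ 2 + d ^+ 2)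
    - (a * c - b * d) ^+ 2 by ring.
  by rewrite ab cd mulr1 lerBlDr lerDl sqr_ge0.
have mle : b * c - a * d <= Num.sqrt (1 - q ^+ 2).
  have -> : 1 - q ^+ 2 = (b * c - a * d) ^+ 2 + ((a * c + b * d) ^+ 2 - q ^+ 2).
    rewrite addrA; congr (_ - _).
    have <- : (a ^+ 2 + b ^+ 2) * (c ^+ 2 + d ^+ 2) = 1 by rewrite ab cd mulr1.
    ring.
  apply: le_trans (ler_norm _) _; rewrite -sqrtr_sqr ler_wsqrtr // lerDl.
  by rewrite subr_ge0 ler_pXn2r ?nnegrE // (le_trans q0).
lra.
Qed.

(** With c = cos t and s = sin t, the expression is the modulus of the value of
    a pair after rotating it by the angle t in a plane (see [qrange_shrink]).
    The rotation starts at s = 0 and ends at s = n, c = a, where the first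
    factor vanishes. Parametrizing by the sine, c = sqrt (1 - s^2), suffices
    because a >= 0 keeps the path in the first quadrant. *)
Lemma rotation_modulus_ivt (R : realType) (a n k rho : R) (g d : R[i]) :
  0 <= a -> 0 < n -> a ^+ 2 + n ^+ 2 = 1 -> 0 <= rho <= n * k * modulus g ->
  exists s c : R, c ^+ 2 + s ^+ 2 = 1 /\
    `|n * c - a * s| * k * modulus (g * c%:C + d * s%:C) = rho.
Proof.
move=> a0 n0 an rhoP.
pose c (s : R) := Num.sqrt (1 - s ^+ 2).
pose f (s : R) := `|n * c s - a * s| * k * Num.sqrt
  ((complex.Re g * c s + complex.Re d * s) ^+ 2 +
   (complex.Im g * c s + complex.Im d * s) ^+ 2).
have fE s : f s = `|n * c s - a * s| * k * modulus (g * (c s)%:C + d * s%:C).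
  rewrite /f; case: (g) (d) => [g1 g2] [d1 d2] /=.
  by rewrite /modulus /= !mulr0 !subr0 !add0r.
have csq (h : R -> R) : continuous h -> continuous (fun s => h s ^+ 2).
  by move=> hc s; under eq_fun do rewrite expr2; apply: cvgM; exact: hc.
have cc : continuous c.
  move=> s; apply: continuous_comp; last exact: sqrt_continuous.
  by apply: cvgB; [exact: cvg_cst | exact: exprn_continuous].
have cl (u v : R) : continuous (fun s => u * c s + v * s).
  move=> s; apply: cvgD; apply: cvgM; try exact: cvg_cst; last exact: cvg_id.
  exact: cc.
have cf : continuous f.
  move=> s; apply: cvgM; first apply: cvgM; last 2 first.
  - exact: cvg_cst.
  - apply: continuous_comp; last exact: sqrt_continuous.
    apply: cvgD; [have := csq _ (cl (complex.Re g) (complex.Re d)) s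
                 | have := csq _ (cl (complex.Im g) (complex.Im d)) s]; exact.
  apply: cvg_norm; have := cl n (- a) s.
  by under eq_fun do rewrite mulNr.
have f0 : f 0 = n * k * modulus g.
  by rewrite fE /c expr0n subr0 sqrtr1 !mulr1 !mulr0 subr0 addr0 gtr0_norm.
have fn : f n = 0.
  have -> : f n = `|n * c n - a * n| * k * modulus (g * (c n)%:C + d * n%:C).
    exact: fE.
  rewrite /c -an addrK sqrtr_sqr (ger0_norm a0) [a * n]mulrC subrr normr0.
  by rewrite !mul0r.
have /andP[rho0 rho1] := rhoP.
have [||s sn fs] := @IVT R f 0 n rho (ltW n0).
- exact: continuous_subspaceT.
- by rewrite f0 fn; apply/andP; split;
    rewrite ?ge_min ?le_max ?rho0 ?rho1 ?orbT.
exists s, (c s); split; last by rewrite -fE.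
rewrite sqr_sqrtr ?subrK // subr_ge0.
move: sn; rewrite in_itv /= => /andP[s0 sn].
rewrite -an (@le_trans _ _ (n ^+ 2)) ?lerDr ?sqr_ge0 //.
by rewrite ler_pXn2r ?nnegrE ?(ltW n0).
Qed.

(** The condition on phi says |phi| = 1; for a = 0 the phase is arbitrary. *)
Lemma unit_polar (R : realType) (a : R[i]) :
  exists2 phi : R[i], Num.conj phi * phi = 1 & a = (modulus a)%:C * phi.
Proof.
have [->|a0] := eqVneq a 0.
  by exists 1; rewrite ?rmorph1 ?mulr1 // /modulus ComplexField.Normc.normc0.
have m0 : (modulus a)%:C != 0 by rewrite modulusE normr_eq0.
exists ((modulus a)%:C^-1 * a); last by rewrite mulrA divff ?mul1r.
rewrite rmorphM fmorphV /= [Num.conj _%:C]conjc_real.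
have := modulus_sqr a; rewrite rmorphXn /= => aE.
have -> : forall u v w : R[i], u^-1 * v * (u^-1 * w) = (w * v) / u ^+ 2.
  by move=> u v w; rewrite -exprVn; ring.
by rewrite -aE divff // expf_neq0.
Qed.

(** * The q-numerical range of an operator of square zero *)

Definition qrange (R : realType) (V : lmodType R[i]) (B : V -> V -> R[i])
    (q : R[i]) (T : V -> V) : set R[i] :=
  [set z | exists x y, [/\ B x x = 1, B y y = 1, B x y = q & z = B (T x) y]].

Section Nilpotent.
Context (R : realType) (V : lmodType R[i]) (B : V -> V -> R[i]).
Hypothesis BP : semi_inner B.
Context (T : {linear V -> V}).
Hypothesis T2 : forall x z, B (T (T x)) z = 0.

(** The vector e is Tx normalized. The last conclusion is the workhorse: T
    kills e up to a negligible vector, and sends v to ||Tx|| e. *)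
Lemma range_frame x y : 0 < seminorm B (T x) ->
  exists e a b v v',
    [/\ B e e = 1, B v e = 0, B v' e = 0, x = a *: e + v & y = b *: e + v'] /\
    forall al be z,
      B (T (al *: e + be *: v)) z = be * (seminorm B (T x))%:C * B e z.
Proof.
move=> K0; have Kn0 : (seminorm B (T x))%:C != 0.
  by rewrite (inj_eq (@complexI R) _ 0) gt_eqF.
pose e := (seminorm B (T x))%:C^-1 *: T x.
have e1 : B e e = 1.
  rewrite (siZl BP) (siZr BP) fmorphV /= [Num.conj _%:C]conjc_real.
  by rewrite (seminormE BP) rmorphXn /=; field.
have [v xE ve] := si_split BP x e1; have [v' yE v'e] := si_split BP y e1.
exists e, (B x e), (B y e), v, v'; split=> // al be z.
have Te w : B (T e) w = 0 by rewrite linearZ_LR (siZl BP) T2 mulr0.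
have Txw w : B (T x) w = (seminorm B (T x))%:C * B e w.
  by rewrite (siZl BP) mulrA divff // mul1r.
have -> : v = x - B x e *: e by rewrite [X in X - _]xE addrAC subrr add0r.
move: (B x e) Te Txw => c Te Txw; clearbody e.
rewrite linearD [T (al *: _)]linearZ_LR [T (be *: _)]linearZ_LR linearB.
rewrite [T (c *: _)]linearZ_LR (siDl BP) !(siZl BP).
rewrite (siDl BP) (siNl BP) !(siZl BP) Te Txw.
by rewrite !mulr0 add0r subr0 mulrA.
Qed.

(** Multiplying the components of x and y orthogonal to Tx by w preserves every
    inner product of the pair, and multiplies Tx by w. *)
Lemma qrange_rotate q z w : qrange B q T z -> modulus w = 1 ->
  qrange B q T (w * z).
Proof.
move=> [x [y [x1 y1 xy ->]]] w1.
have [z0|z0] := eqVneq (B (T x) y) 0; first by rewrite z0 mulr0; exists x, y.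
have [e [a [b [v [v' [[e1 ve v'e xE yE] TE]]]]]] :=
  range_frame y (seminorm_gt0 BP z0).
have ww : w * Num.conj w = 1 by rewrite -modulus_sqr w1 expr1n.
have rotE a1 u b1 u' : B u e = 0 -> B u' e = 0 ->
    B (a1 *: e + w *: u) (b1 *: e + w *: u') = B (a1 *: e + u) (b1 *: e + u').
  move=> ue u'e.
  rewrite !(si_cat BP) ?(siZl BP) ?ue ?u'e ?mulr0 //.
  by rewrite (siZr BP) mulrA ww mul1r.
exists (a *: e + w *: v), (b *: e + w *: v').
split; rewrite ?rotE -?xE -?yE // TE.
rewrite (si_unit_coord BP) ?(siZl BP) ?v'e ?mulr0 //.
rewrite {1}xE -[v in T (_ + v)]scale1r TE yE (si_unit_coord BP) //.
by rewrite -!mulrA mul1r.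
Qed.

(** Rotating x and y together in a plane preserves the constraints. In the
    plane of e = Tx / ||Tx|| and f = v / ||v||, with x = a e + v, some rotation
    carries x to a multiple of e, where the value is 0; intermediate moduli
    come from continuity. A real rotation does this only if the coefficient of
    x along the first axis is real; replacing e with e' = phi e for a unit phi
    makes it |a|. *)
Lemma qrange_shrink q z rho :
  (forall x, seminorm B x = 0 -> seminorm B (T x) = 0) ->
  qrange B q T z -> 0 <= rho <= modulus z ->
  exists2 z', qrange B q T z' & modulus z' = rho.
Proof.
move=> Tnull [x [y [x1 y1 xy ->]]] rhoP.
have [z0|z0] := eqVneq (B (T x) y) 0.
  exists (B (T x) y); first by exists x, y.
  apply/esym/eqP; rewrite eq_le andbC; move: rhoP.
  by rewrite z0 /modulus ComplexField.Normc.normc0.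
have K0 := seminorm_gt0 BP z0.
have [e [a [b [v [v' [[e1 ve v'e xE yE] TE]]]]]] := range_frame y K0.
set K := seminorm B (T x) in K0 TE.
have Tv w : B (T v) w = K%:C * B e w.
  by have := TE 0 1 w; rewrite scale0r add0r scale1r mul1r.
have n0 : 0 < seminorm B v.
  rewrite lt_def seminorm_ge0 andbT; apply/negP => /eqP /Tnull Tv0.
  have : B (T v) e != 0.
    by rewrite Tv e1 mulr1 (inj_eq (@complexI R) _ 0) gt_eqF.
  by move/(seminorm_gt0 BP); rewrite Tv0 ltxx.
set n := seminorm B v in n0.
have nC0 : n%:C != 0 by rewrite (inj_eq (@complexI R) _ 0) gt_eqF.
have [phi phi1 aE] := unit_polar a.
have phi1' : phi * Num.conj phi = 1 by rewrite mulrC.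
set m := modulus a in aE.
have mn : m ^+ 2 + n ^+ 2 = 1.
  apply: complexI; rewrite rmorphD /= -(seminormE BP) modulus_sqr.
  by rewrite -(si_cat BP a a e1 ve ve) -xE x1.
pose e' := phi *: e; pose f := n%:C^-1 *: v.
have e'1 : B e' e' = 1 by rewrite (siZl BP) (siZr BP) e1 mulr1.
have f1 : B f f = 1.
  rewrite (siZl BP) (siZr BP) fmorphV /= [Num.conj n%:C]conjc_real.
  by rewrite (seminormE BP) -/n rmorphXn /=; field.
have fe' : B f e' = 0 by rewrite (siZl BP) (siZr BP) ve !mulr0.
have xE' : x = m%:C *: e' + n%:C *: f.
  by rewrite !scalerA divff // scale1r -aE.
pose g := b * Num.conj phi.
have [p v'E pf] := si_split BP v' f1.
set d := B v' f in v'E.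
have fe : B f e = 0 by rewrite (siZl BP) ve mulr0.
have pe : B p e = 0.
  by move: v'e; rewrite v'E (siDl BP) (siZl BP) fe mulr0 add0r.
have pe' : B p e' = 0 by rewrite (siZr BP) pe mulr0.
have yE' : y = g *: e' + (d *: f + p).
  by rewrite -v'E scalerA -mulrA phi1 mulr1.
have fE : f = n%:C^-1 *: v by [].
have e'E : e' = phi *: e by [].
clearbody f e' d.
have si00 w : B 0 w = 0 := si0l BP w.
have frame a1 a2 b1 b2 u : B u e' = 0 -> B u f = 0 ->
    B (a1 *: e' + (a2 *: f + u)) (b1 *: e' + (b2 *: f + p)) =
    a1 * Num.conj b1 + (a2 * Num.conj b2 + B u p).
  move=> ue uf.
  by rewrite !(si_cat BP) // (siDl BP) (siZl BP) fe' ?ue ?pe' mulr0 add0r.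
have framex a1 a2 : B (a1 *: e' + a2 *: f) (a1 *: e' + a2 *: f) =
    a1 * Num.conj a1 + a2 * Num.conj a2.
  rewrite (si_cat BP) // ?(siZl BP) ?fe' ?mulr0 //.
  by rewrite (siZr BP) f1 mulr1.
have framexy a1 a2 b1 b2 :
    B (a1 *: e' + a2 *: f) (b1 *: e' + (b2 *: f + p)) =
    a1 * Num.conj b1 + a2 * Num.conj b2.
  by rewrite -[a2 *: f]addr0 frame ?si00 // addr0.
have modphi : modulus phi = 1.
  apply/eqP; rewrite -(@eqrXn2 _ 2) ?modulus_ge0 // expr1n.
  by apply/eqP/complexI; rewrite modulus_sqr.
have Tval a2 a1 b1 b2 : modulus
      (B (T (a1 *: e' + a2%:C *: f)) (b1 *: e' + (b2 *: f + p))) =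
    `|a2| * (K / n) * modulus b1.
  rewrite e'E fE !scalerA TE (si_unit_coord BP) //; last first.
    by rewrite (siDl BP) (siZl BP) ve pe mulr0 addr0.
  rewrite -fmorphV !modulusM modulusJ modulusM modphi !modulusR mulr1.
  rewrite (gtr0_norm K0) (@gtr0_norm _ n^-1) ?invr_gt0 //.
  by rewrite [K / n]mulrC mulrA.
have [|s [c [cs rhoE]]] :=
    @rotation_modulus_ivt R m n (K / n) rho g d (modulus_ge0 _) n0 mn.
  have -> : n * (K / n) * modulus g = modulus (B (T x) y) => //.
  by rewrite xE' yE' Tval (gtr0_norm n0).
have csC : c%:C * c%:C + s%:C * s%:C = 1.
  by rewrite -!rmorphM -rmorphD /= -!expr2 cs.
have Jc (r : R) : Num.conj r%:C = r%:C := conjc_real r.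
(* The pair (x, y) rotated by the angle with cosine c and sine s; the component
   p of y orthogonal to the plane does not move. *)
pose x' := (m * c + n * s)%:C *: e' + (n * c - m * s)%:C *: f.
pose y' := (g * c%:C + d * s%:C) *: e' + ((d * c%:C - g * s%:C) *: f + p).
exists (B (T x') y'); last by rewrite Tval.
have ssC : s%:C * s%:C = 1 - c%:C * c%:C by rewrite -csC addrC addKr.
exists x', y'; split=> //.
- rewrite -x1 xE' !framex !Jc !(rmorphD, rmorphN, rmorphM) /=.
  ring: ssC.
- rewrite -y1 yE' !frame // !(rmorphD, rmorphN, rmorphM) /= !Jc.
  ring: ssC.
- rewrite -xy xE' yE' !framexy !(rmorphD, rmorphN, rmorphM) /= !Jc.
  ring: ssC.
Qed.

(** In the plane of e = Tx0 / ||Tx0|| and f = v / ||v||, T sends f to k e and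
    e to a negligible vector, with k nonzero. If |q| < 1, the pair x = f,
    y = conj(q) f + sqrt (1 - |q|^2) e has value k sqrt (1 - |q|^2). If
    |q| = 1 this vanishes, and y has to agree with conj(q) x up to a null
    vector; then x = (e + f) / sqrt 2 gives q k / 2. *)
Lemma qrange_neq0 q x0 : modulus q <= 1 ->
  (forall x, seminorm B x = 0 -> seminorm B (T x) = 0) ->
  0 < seminorm B (T x0) -> exists2 z, qrange B q T z & z != 0.
Proof.
move=> q1 Tnull K0.
have [e [a [_ [v [_ [[e1 ve _ _ _] TE]]]]]] := range_frame x0 K0.
have KC0 : (seminorm B (T x0))%:C != 0.
  by rewrite (inj_eq (@complexI R) _ 0) gt_eqF.
have n0 : seminorm B v != 0.
  apply/eqP => /Tnull Tv0.
  have : B (T v) e != 0.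
    by have := TE 0 1 e; rewrite scale0r add0r scale1r mul1r e1 mulr1 => ->.
  by move/(seminorm_gt0 BP); rewrite Tv0 ltxx.
have nC0 : (seminorm B v)%:C != 0 by rewrite (inj_eq (@complexI R) _ 0).
have Jc (r : R) : Num.conj r%:C = r%:C := conjc_real r.
have Tf al be z : B (T (al *: e + be *: ((seminorm B v)%:C^-1 *: v))) z =
    be * ((seminorm B v)%:C^-1 * (seminorm B (T x0))%:C) * B e z.
  by rewrite scalerA TE !mulrA.
have : B ((seminorm B v)%:C^-1 *: v) ((seminorm B v)%:C^-1 *: v) = 1.
  rewrite (siZl BP) (siZr BP) fmorphV /= Jc (seminormE BP) rmorphXn /=.
  by field.
have : B ((seminorm B v)%:C^-1 *: v) e = 0 by rewrite (siZl BP) ve mulr0.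
have : (seminorm B v)%:C^-1 * (seminorm B (T x0))%:C != 0.
  by rewrite mulf_neq0 ?invr_eq0.
move: (_^-1 *: v) (_ * _) Tf => f k Tf k0 fe f1.
have ef := si_eq0C BP fe.
have [q1'|qlt] := eqVneq (modulus q) 1.
  have qq : q * Num.conj q = 1 by rewrite -modulus_sqr q1' expr1n.
  pose h : R[i] := (Num.sqrt 2^-1)%:C.
  have hh : h * h = 2^-1.
    by rewrite -rmorphM -expr2 sqr_sqrtr // fmorphV rmorph_nat.
  have hJ : Num.conj h = h := Jc _.
  pose x := h *: e + h *: f.
  have x1 : B x x = 1.
    rewrite (siDl BP) !(siDr BP) !(siZl BP) !(siZr BP) e1 f1 ef fe hJ.
    by rewrite !mulr0 addr0 add0r mulr1 hh; field.
  exists (q * (h * k * h)).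
    exists x, (Num.conj q *: x); split=> //.
    - by rewrite (siZl BP) (siZr BP) x1 conjCK mulr1 mulrC qq.
    - by rewrite (siZr BP) x1 conjCK mulr1.
    rewrite Tf !(siZr BP) conjCK (siDr BP) !(siZr BP) e1 ef hJ; ring.
  have qn0 : q != 0 by rewrite -modulus_eq0 q1' oner_eq0.
  by rewrite mulf_neq0 // mulrAC hh mulf_neq0 // invr_eq0 pnatr_eq0.
have s0 : 0 < 1 - modulus q ^+ 2.
  by rewrite subr_gt0 expr_lt1 ?modulus_ge0 // lt_neqAle qlt q1.
pose s : R[i] := (Num.sqrt (1 - modulus q ^+ 2))%:C.
have ss : s * s = 1 - q * Num.conj q.
  by rewrite -rmorphM -expr2 sqr_sqrtr ?ltW // rmorphB rmorph1 /= modulus_sqr.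
have sJ : Num.conj s = s := Jc _.
exists (k * s).
  exists f, (Num.conj q *: f + s *: e); split=> //.
  - rewrite (siDl BP) !(siDr BP) !(siZl BP) !(siZr BP) e1 f1 ef fe sJ conjCK.
    ring: ss.
  - by rewrite (siDr BP) !(siZr BP) f1 fe conjCK mulr0 addr0 mulr1.
  have := Tf 0 1 (Num.conj q *: f + s *: e).
  rewrite scale0r add0r scale1r mul1r => ->.
  by rewrite (siDr BP) !(siZr BP) e1 ef sJ mulr0 add0r mulr1.
by rewrite mulf_neq0 // (inj_eq (@complexI R) _ 0) gt_eqF ?sqrtr_gt0.
Qed.

(** The value is ||Tv|| conj(b) in the frame of [range_frame], because Tv and Tx
    agree up to a negligible vector; the orthogonal splitting and
    Cauchy-Schwarz on the parts orthogonal to e put the coefficients in the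
    form required by [half_bound]. *)
Lemma qrange_bound q z M :
  (forall x, seminorm B (T x) <= M * seminorm B x) -> 0 <= M ->
  qrange B q T z -> modulus z <= (1 + Num.sqrt (1 - modulus q ^+ 2)) / 2 * M.
Proof.
move=> TM M0 [x [y [x1 y1 xy ->]]].
have [->|z0] := eqVneq (B (T x) y) 0.
  rewrite /modulus ComplexField.Normc.normc0.
  by rewrite mulr_ge0 ?divr_ge0 ?addr_ge0 ?sqrtr_ge0.
have K0 := seminorm_gt0 BP z0.
have [e [a [b [v [v' [[e1 ve v'e xE yE] TE]]]]]] := range_frame y K0.
set K := seminorm B (T x) in K0 TE.
have split1 c u : B u e = 0 -> B (c *: e + u) (c *: e + u) = 1 ->
    modulus c ^+ 2 + seminorm B u ^+ 2 = 1.
  move=> ue; rewrite (si_cat BP) // => h; apply: complexI.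
  by rewrite rmorphD /= modulus_sqr -(seminormE BP).
have KM : K <= M * seminorm B v.
  have -> : K = seminorm B (T v).
    have Tv w : B (T v) w = K%:C * B e w.
      by have := TE 0 1 w; rewrite scale0r add0r scale1r mul1r.
    have Te w : B w (T v) = K%:C * B w e.
      by rewrite (siC BP) Tv rmorphM /= -(siC BP) [Num.conj _]conjc_real.
    apply/eqP; rewrite -(@eqrXn2 _ 2) ?seminorm_ge0 ?(ltW K0) //.
    apply/eqP/complexI; rewrite -[RHS](seminormE BP) Tv Te e1 mulr1.
    by rewrite -rmorphM.
  exact: TM.
have -> : modulus (B (T x) y) = K * modulus b.
  have := TE a 1 y; rewrite scale1r -xE mul1r {2}yE (si_unit_coord BP) // => ->.
  by rewrite modulusM modulusR modulusJ gtr0_norm.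
have vb : seminorm B v * modulus b <= (1 + Num.sqrt (1 - modulus q ^+ 2)) / 2.
  apply: (@half_bound _ _ (modulus a) _ _ (seminorm B v'));
    rewrite ?seminorm_ge0 ?modulus_ge0 ?split1 -?xE -?yE //=.
  rewrite -xy xE yE (si_cat BP) //.
  apply: le_trans (modulusD _ _) _; rewrite modulusM modulusJ lerD2l.
  exact: cauchy_schwarz.
apply: le_trans (ler_wpM2r (modulus_ge0 b) KM) _.
by rewrite -[leLHS]mulrA [leRHS]mulrC; exact: ler_wpM2l.
Qed.

End Nilpotent.

(** * The form of a positive operator on a Hilbert space *)

(** Polarization: over the complex numbers, a sesquilinear form that is real on
    the diagonal is Hermitian. Compare the imaginary parts at x + y and
    x + i y. *)
Lemma semi_inner_of_pos (R : realType) (V : lmodType R[i])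
    (B : V -> V -> R[i]) :
  (forall x y z, B (x + y) z = B x z + B y z) ->
  (forall a x z, B (a *: x) z = a * B x z) ->
  (forall x y z, B z (x + y) = B z x + B z y) ->
  (forall a x z, B z (a *: x) = Num.conj a * B z x) ->
  (forall x, 0 <= B x x) -> semi_inner B.
Proof.
move=> Dl Zl Dr Zr ge0; split=> // x y.
have real u : Num.conj (B u u) = B u u by rewrite conj_Creal ?ger0_real.
have := real (x + y); have := real (x + 'i *: y).
rewrite !Dl !Dr !Zl !Zr !(rmorphD, rmorphM) /= !real conjCK conjCi => h1 h2.
have ii : 'i * 'i = -1 :> R[i] by rewrite -expr2 sqrCi.
apply: (@mulfI _ 2); first by rewrite pnatr_eq0.
move: (B x x) (B y y) (B x y) (B y x) (Num.conj (B x y)) (Num.conj (B y x))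
  h1 h2 => a b p r p' r' h1 h2.
apply/eqP; rewrite -subr_eq0.
have -> : 2 * p - 2 * r' = (a + p + (r + b)) - (a + p' + (r' + b)) - 'i *
    ((a + 'i * p' + (- 'i * r' + - 'i * ('i * b))) -
     (a + - 'i * p + ('i * r + 'i * (- 'i * b)))) by ring: ii.
by rewrite h1 h2 !subrr mulr0 subr0.
Qed.

Section PositiveOperator.
Context (R : realType) (H : normedModType R[i]).
Context (dot : {dot H for Num.Def.conjC}).
Hypothesis Hdot : inner_product_norm dot.
Context (A : {linear H -> H}).
Hypothesis Apos : positive_operator dot A.

Lemma dot_semi_inner : semi_inner dot.
Proof.
split.
- by move=> x y z; rewrite linearDl.
- by move=> a x z; rewrite linearZl_LR.
- by move=> x y; rewrite hermC /= expr0 mul1r.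
- by move=> x; rewrite -Hdot exprn_ge0.
Qed.

Lemma inner_A_semi_inner : semi_inner (inner_A dot A).
Proof.
have dP := dot_semi_inner.
apply: semi_inner_of_pos => //; rewrite /inner_A.
- by move=> x y z; rewrite linearD (siDl dP).
- by move=> a x z; rewrite linearZ_LR (siZl dP).
- by move=> x y z; rewrite (siDr dP).
- by move=> a x z; rewrite (siZr dP).
Qed.

Lemma seminorm_dot x : (seminorm dot x)%:C = `|x|.
Proof.
apply/eqP; rewrite -(@eqrXn2 _ 2) ?ler0c ?seminorm_ge0 //.
by rewrite Hdot (seminormE dot_semi_inner) rmorphXn.
Qed.

(** Iterate u |-> u - (1/M) A u from x, for M a bound of A. Each step changes
    the vector by an element of the range of A and decreases its squared norm
    by at least ||u||_A^2 / M, because ||Au||^2 <= M ||u||_A^2. If ||u||_A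
    stayed away from 0 the squared norm would become negative. *)
Lemma range_seminorm_dense : bounded_operator A ->
  forall x (eps : R), 0 < eps ->
  exists z, seminorm (inner_A dot A) (x - A z) < eps.
Proof.
move=> [C AC] x eps eps0.
have dP := dot_semi_inner; have BP := inner_A_semi_inner.
set N := seminorm dot; set S := seminorm (inner_A dot A).
pose M := `|C| + 1.
have M0 : 0 < M by rewrite ltr_wpDl.
have AM u : N (A u) <= M * N u.
  rewrite -lecR rmorphM /= !seminorm_dot (le_trans (AC u)) //.
  by rewrite ler_wpM2r // lecR (le_trans (ler_norm C)) // lerDl.
have NA u : N (A u) ^+ 2 <= M * S u ^+ 2.
  have Nu0 := seminorm_ge0 dot u; have NAu0 := seminorm_ge0 dot (A u).
  have Su0 := seminorm_ge0 (inner_A dot A) u.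
  have SA0 := seminorm_ge0 (inner_A dot A) (A u).
  have h1 : N (A u) ^+ 2 <= S u * S (A u).
    have := cauchy_schwarz BP u (A u).
    by rewrite /inner_A (seminormE dP) modulusR ger0_norm ?sqr_ge0.
  have h2 : S (A u) ^+ 2 <= M * N (A u) ^+ 2.
    have := cauchy_schwarz dP (A (A u)) (A u).
    rewrite -[dot _ _]/(inner_A dot A (A u) (A u)) (seminormE BP) modulusR.
    rewrite ger0_norm ?sqr_ge0 // => h; apply: le_trans h _.
    by rewrite expr2 mulrA ler_wpM2r.
  have [->|NAn0] := eqVneq (N (A u)) 0.
    by rewrite expr0n mulr_ge0 ?sqr_ge0 ?(ltW M0).
  have NAp : 0 < N (A u) ^+ 2 by rewrite exprn_gt0 // lt_def NAn0.
  rewrite -(@ler_pM2r _ (N (A u) ^+ 2)) //.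
  apply: (@le_trans _ _ ((S u * S (A u)) ^+ 2)).
    by rewrite -expr2 ler_pXn2r ?nnegrE ?sqr_ge0 ?mulr_ge0.
  have -> : M * S u ^+ 2 * N (A u) ^+ 2 = S u ^+ 2 * (M * N (A u) ^+ 2) by ring.
  rewrite exprMn.
  by apply: ler_wpM2l h2; exact: sqr_ge0.
pose st u := u - (M^-1)%:C *: A u.
have stE u : N (st u) ^+ 2 <= N u ^+ 2 - M^-1 * S u ^+ 2.
  have -> : N (st u) ^+ 2 =
      N u ^+ 2 - 2 * M^-1 * S u ^+ 2 + M^-1 ^+ 2 * N (A u) ^+ 2.
    have AuE : dot (A u) u = (S u ^+ 2)%:C by rewrite -(seminormE BP).
    have uAE : dot u (A u) = (S u ^+ 2)%:C.
      by rewrite (siC dP) AuE [LHS]conjc_real.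
    apply: complexI; rewrite -(seminormE dP) /st (siDl dP) !(siDr dP).
    rewrite !(siNl dP) !(siNr dP) !(siZl dP) !(siZr dP) AuE uAE !(seminormE dP).
    rewrite [Num.conj _%:C]conjc_real -/N.
    move: (N u ^+ 2) (N (A u) ^+ 2) (S u ^+ 2) (M^-1) => a b c d.
    rewrite [d ^+ 2]expr2 !(rmorphD, rmorphN, rmorphM) /= ?rmorph_nat.
    ring.
  have : M^-1 ^+ 2 * N (A u) ^+ 2 <= M^-1 * S u ^+ 2.
    apply: le_trans (ler_wpM2l (sqr_ge0 _) (NA u)) _.
    by rewrite expr2 mulrA mulfVK // gt_eqF.
  lra.
apply: contrapT => nz.
have big z : eps <= S (x - A z).
  by rewrite leNgt; apply/negP => h; apply: nz; exists z.
have iterE k : exists z, iter k st x = x - A z.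
  elim: k => [|k [z kE]]; first by exists 0; rewrite linear0 subr0.
  exists (z + (M^-1)%:C *: (x - A z)).
  by rewrite iterS kE /st linearD [A (_ *: _)]linearZ_LR opprD addrA.
have dec k : N (iter k st x) ^+ 2 <= N x ^+ 2 - k%:R * (M^-1 * eps ^+ 2).
  elim: k => [|k IH]; first by rewrite mul0r subr0.
  rewrite iterS; apply: le_trans (stE _) _.
  have : M^-1 * eps ^+ 2 <= M^-1 * S (iter k st x) ^+ 2.
    have [z ->] := iterE k.
    rewrite ler_wpM2l ?invr_ge0 ?(ltW M0) //.
    by rewrite ler_pXn2r ?nnegrE ?(ltW eps0) ?seminorm_ge0 ?big.
  rewrite -natr1 mulrDl mul1r; move: IH; lra.
have d0 : 0 < M^-1 * eps ^+ 2 by rewrite mulr_gt0 ?invr_gt0 ?exprn_gt0.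
pose k := Num.bound (N x ^+ 2 / (M^-1 * eps ^+ 2)).
have kP : N x ^+ 2 < k%:R * (M^-1 * eps ^+ 2).
  by rewrite -ltr_pdivrMr // archi_boundP // divr_ge0 ?sqr_ge0 ?(ltW d0).
have := dec k; have := sqr_ge0 (N (iter k st x)); lra.
Qed.

(** The supremum defining the norm bounds T on the range of A, and the A-density
    of that range extends the bound to every vector. The vector on which A does
    not vanish makes the set of quotients nonempty; otherwise its supremum
    would be -oo. *)
Lemma opnorm_A_bound (T : {linear H -> H}) :
  bounded_operator A -> A_bounded dot A T -> (exists x, A x <> 0) ->
  exists M : R, [/\ opnorm_A dot A T = M%:E, 0 <= M &
    forall x, seminorm (inner_A dot A) (T x) <=
              M * seminorm (inner_A dot A) x].
Proof.
move=> Abd [c [c0 Tc]] [x0 Ax0].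
have BP := inner_A_semi_inner.
pose S := seminorm (inner_A dot A).
rewrite -[norm_A dot A]/S in Tc; rewrite -/S.
pose E := [set (S (T x) / S x)%:E |
  x in [set x | closure (range A) x /\ x <> 0]].
rewrite -[opnorm_A _ _ _]/(ereal_sup E).
have S0 x : 0 <= S x := seminorm_ge0 _ _.
have ubE x : closure (range A) x -> x <> 0 ->
    ((S (T x) / S x)%:E <= ereal_sup E)%E.
  by move=> xA xn0; apply: ereal_sup_ubound; exists x.
have Ec : (ereal_sup E <= c%:E)%E.
  apply: ge_ereal_sup => _ [x _ <-]; rewrite lee_fin.
  have [Sx0|Sxn0] := eqVneq (S x) 0.
    by rewrite Sx0 invr0 mulr0 ltW.
  by rewrite ler_pdivrMr ?Tc // lt_def Sxn0 S0.
have rA z : closure (range A) (A z) by apply: subset_closure; exists z.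
have E0 : (0 <= ereal_sup E)%E.
  apply: le_trans (ubE (A x0) (rA _) Ax0); rewrite lee_fin divr_ge0 //.
have [M ME] : exists M, ereal_sup E = M%:E.
  exists (fine (ereal_sup E)); rewrite fineK //.
  by rewrite ge0_fin_numE // (le_lt_trans Ec) ?ltry.
rewrite ME in ubE E0 *; exists M; rewrite -lee_fin; split=> // x.
have TMr z : S (T (A z)) <= M * S (A z).
  have [Sz0|Szn0] := eqVneq (S (A z)) 0.
    by have := Tc (A z); rewrite Sz0 !mulr0.
  rewrite -ler_pdivrMr -?lee_fin; last by rewrite lt_def Szn0 S0.
  apply: ubE => // Az0; move: Szn0.
  by rewrite Az0 /S /seminorm (si0l BP) /= sqrtr0 eqxx.
have M0 : 0 <= M by rewrite -lee_fin.
apply/ler_addgt0Pr => eps eps0.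
have d0 : 0 < eps / (M + c) by rewrite divr_gt0 // ltr_wpDl.
have [z zlt] := range_seminorm_dense Abd x d0.
have h1 : S (T x) <= S (T (x - A z)) + S (T (A z)).
  have := seminormD BP (T (x - A z)) (T (A z)).
  by rewrite -linearD subrK.
have h2 : S (A z) <= S x + S (x - A z).
  have := seminormD BP x (- (x - A z)).
  by rewrite subKr (seminormN BP).
have h3 := Tc (x - A z).
have h4 := ler_wpM2l M0 h2.
have h5 : (M + c) * S (x - A z) <= eps.
  by rewrite mulrC -ler_pdivlMr ?ltW // ltr_wpDl.
have := TMr z; move: h1 h3 h4 h5; rewrite mulrDr mulrDl; lra.
Qed.

End PositiveOperator.

(** * A-nilpotent operators of index two *)

Theorem theorem3p2 (R : realType) (H : completeNormedModType R[i])
    (dot : {dot H for Num.Def.conjC})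
    (Hdot : inner_product_norm dot)
    (Hsep : separable H)
    (Hinf : ~ finite_dimensional H)
    (A : {linear H -> H})
    (Abounded : bounded_operator A)
    (Apos : positive_operator dot A)
    (Aclosed : closed (range A))
    (q : R[i]) (Hq : modulus q <= 1)
    (T : {linear H -> H})
    (Tbounded : bounded_operator T)
    (TAbounded : A_bounded dot A T)
    (Tnil : A_nilpotent A 2 T) :
  is_disk 0 (numerical_range_A dot A q T) /\
  (numerical_radius_A dot A q T <=
     ((1 + Num.sqrt (1 - modulus q ^+ 2)) / 2)%:E * opnorm_A dot A T)%E.
Proof.
have [_ AT2 [x0 ATx0]] := Tnil.
have BP := inner_A_semi_inner Hdot Apos.
have T2 x z : inner_A dot A (T (T x)) z = 0.
  by rewrite /inner_A [A _]AT2 (si0l (dot_semi_inner Hdot)).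
have [M [-> M0 TM]] := opnorm_A_bound Hdot Apos Abounded TAbounded
  (ex_intro _ (T x0) ATx0).
(* An A-null vector has an A-null image, so T acts on the quotient. *)
have Tnull x : seminorm (inner_A dot A) x = 0 ->
    seminorm (inner_A dot A) (T x) = 0.
  move=> x0'; apply/eqP; rewrite eq_le seminorm_ge0 andbT.
  by rewrite (le_trans (TM x)) // x0' mulr0.
have WE : numerical_range_A dot A q T = qrange (inner_A dot A) q T.
  apply/seteqP; split=> z [x [y [x1 y1 xy zE]]]; exists x, y; split=> //;
    by apply/(seminorm_eq1 BP).
have Wbound z := qrange_bound BP T2 TM M0 (q := q) (z := z).
rewrite /numerical_radius_A WE; split; last first.
  by apply: ge_ereal_sup => _ [z Wz <-]; rewrite -EFinM lee_fin Wbound.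
apply: balanced_is_disk Wbound _; last first.
  apply: (qrange_neq0 BP T2 (x0 := x0) Hq Tnull).
  (* Pair T x0 with A (T x0): the value is the squared norm of A (T x0). *)
  apply: (seminorm_gt0 BP (y := A (T x0))).
  rewrite /inner_A; apply/eqP => AA.
  apply: ATx0; apply/eqP; rewrite -normr_eq0 -sqrf_eq0.
  by rewrite Hdot AA.
move=> z w Wz wz.
have [|z' Wz' zw] := qrange_shrink BP T2 Tnull Wz (rho := modulus w).
  by rewrite modulus_ge0.
have [w0|wn0] := eqVneq (modulus w) 0.
  move: zw; rewrite w0 => /eqP; rewrite modulus_eq0 => /eqP z'0.
  by move/eqP: w0; rewrite modulus_eq0 => /eqP ->; rewrite -z'0.
have z'n0 : z' != 0 by rewrite -modulus_eq0 zw.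
(* A point of modulus |w| in the range, rotated onto w. *)
rewrite -[w](@divfK _ z') //; apply: (qrange_rotate BP T2 Wz').
by rewrite modulusM modulusV zw divff.
Qed.
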